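(* Let $\Gamma$ be a topological group, let the $\Gamma$-space $X$ be a general geometric boundary, and let $\alpha,\beta:\Gamma\times X\to\mathbf R$ be two $B$-cocycles. If $\ell_\alpha=\ell_\beta$, then there is a continuous function $\varphi:X\to\mathbf R$ such that $\alpha(\gamma,x)-\beta(\gamma,x)=\varphi(\gamma x)-\varphi(x)$ for all $\gamma\in\Gamma$, $x\in X$. In other words, $[\alpha]=[\beta]$ in $H^1_c(\Gamma,X,\mathbf R)$.
   Context: Hyperbolic elements: for a compact space $X$, a homeomorphism $\phi\ne \mathrm{Id}_X$ of $X$ is hyperbolic if it has two distinct fixed points $\phi^-,\phi^+\in X$ such that, as $n\to+\infty$, $\phi^n$ contracts $X\setminus\{\phi^-\}$ towards $\phi^+$ uniformly on compact subsets, and, as $n\to-\infty$, $\phi^n$ contracts $X\setminus\{\phi^+\}$ towards $\phi^-$ (north-south dynamics). An element $\gamma$ of a group acting on $X$ is called hyperbolic if it acts by a hyperbolic homeomorphism, and $\gamma^+,\gamma^-$ denote its (uniquely determined) attracting and repelling fixed points. For $\gamma\in\Gamma$ hyperbolic on $X$ and $\eta\in\Gamma$ with $\eta\gamma^+\neq\gamma^-$, let $A_{\eta,\gamma}=\{n:\eta\gamma^n\text{ is hyperbolic}\}$. General geometric boundary: a nontrivial compact Hausdorff $\Gamma$-space $X$ such that (1) $\Gamma$ acts on $X$ minimally; (2) there are hyperbolic elements in $\Gamma$, and $\sup A_{\eta,\gamma}=+\infty$ for every hyperbolic $\gamma\in\Gamma$ and every $\eta\in\Gamma$ with $\eta\gamma^+\ne\gamma^-$;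 (3) there are $\Gamma$-quasi-invariant measures $\mu,\mu'$ on $X$ such that the $\Gamma$-action on $(X\times X,\mu\times\mu')$ is ergodic. Cocycles: a cocycle is a continuous function $c:\Gamma\times X\to\mathbf R$ with $c(\gamma\eta,x)=c(\gamma,\eta x)+c(\eta,x)$ for all $\gamma,\eta\in\Gamma$, $x\in X$. $H^1_c(\Gamma,X,\mathbf R)$ is the quotient of the vector space of continuous cocycles by the subspace of those of the form $(\gamma,x)\mapsto\varphi(\gamma x)-\varphi(x)$ with $\varphi:X\to\mathbf R$ continuous. A cocycle $c$ is a $B$-cocycle if $x\mapsto c(\gamma,x)$ is continuous for all $\gamma\in\Gamma$ and there is a continuous function $C:(X\times X)\setminus\Delta\to\mathbf R$ ($\Delta$ the diagonal) with $C(\gamma x,\gamma y)-C(x,y)=c(\gamma,x)+c(\gamma,y)$ for all $\gamma\in\Gamma$, $x\neq y\in X$. Marked length spectrum of a cocycle $\beta$: $\ell_\beta(\langle\gamma\rangle)=\beta(\gamma,\gamma^+)$ for all hyperbolic elements $\gamma\in\Gamma\setminus\{1\}$, where $\langle\gamma\rangle$ is the conjugacy class of $\gamma$. *)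

(* Defs.v *)
(* Written for Mathematical Components and MathComp-Analysis. *)
From HB Require Import structures.
From mathcomp Require Import all_boot all_order all_algebra.
From mathcomp Require Import ring_quotient.
From mathcomp Require Import all_classical all_reals all_analysis.

Set Implicit Arguments.
Unset Strict Implicit.
Unset Printing Implicit Defensive.

Import Order.TTheory GRing.Theory Num.Theory.
Import numFieldNormedType.Exports.

Local Open Scope classical_set_scope.
Local Open Scope ring_scope.
Local Open Scope quotient_scope.

(* The product, unit and inverse of a [groupType] are written in [group_scope],
   delimited by [%g]; [gamma ^ h] is the conjugate [h^-1 * (gamma * h)]. *)
HB.mixin Record isTopologicalGroup G of Group G & Topological G := {
  mulg_continuous : continuous (fun p : G * G => (p.1 * p.2)%g) ;
  invg_continuous : continuous (fun g : G => (g^-1)%g)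
}.

#[short(type="topologicalGroupType")]
HB.structure Definition TopologicalGroup :=
  {G of Group G & Topological G & isTopologicalGroup G}.

Section Dynamics.
Variables (G : topologicalGroupType) (X : ptopologicalType).

Record continuous_action (act : G -> X -> X) : Prop := {
  act1 : forall x, act 1%g x = x ;
  actM : forall g h x, act (g * h)%g x = act g (act h x) ;
  act_continuous : continuous (fun p : G * X => act p.1 p.2)
}.

Definition homeomorphism (f : X -> X) : Prop :=
  exists f' : X -> X,
    [/\ continuous f, continuous f', cancel f f' & cancel f' f].

(* The image of [K] under the n-th iterate of the inverse of the homeomorphism
   [f] is its preimage under the n-th iterate of [f]. *)
Record north_south (f : X -> X) (xm xp : X) : Prop := {
  ns_neq : xm <> xp ;
  ns_fixm : f xm = xm ;
  ns_fixp : f xp = xp ;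
  ns_attract : forall K U : set X, compact K -> ~ K xm -> nbhs xp U ->
    \forall n \near \oo, iter n f @` K `<=` U ;
  ns_repel : forall K U : set X, compact K -> ~ K xp -> nbhs xm U ->
    \forall n \near \oo, iter n f @^-1` K `<=` U
}.

Definition hyperbolic_homeo (f : X -> X) : Prop :=
  [/\ homeomorphism f, f <> id & exists xm xp, north_south f xm xp].

Variable act : G -> X -> X.

Definition hyperbolic (g : G) : Prop := hyperbolic_homeo (act g).

Record hyperbolic_elt := HyperbolicElt {
  hyp_val :> G ;
  hyp_valP : `[< hyperbolic hyp_val >]
}.

HB.instance Definition _ := [isSub for hyp_val].
HB.instance Definition _ := [Choice of hyperbolic_elt by <:].

Lemma hyp_fixpoints (g : hyperbolic_elt) :
  exists p : X * X, north_south (act g) p.1 p.2.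
Proof.
by case: g => g /= /asboolP[_ _ [xm [xp ns]]]; exists (xm, xp).
Qed.

(* Independent of the choice of the pair by [north_south_uniq]. *)
Definition repelling (g : hyperbolic_elt) : X :=
  (projT1 (cid (hyp_fixpoints g))).1.
Definition attracting (g : hyperbolic_elt) : X :=
  (projT1 (cid (hyp_fixpoints g))).2.

Lemma north_south_fix (g : hyperbolic_elt) :
  north_south (act g) (repelling g) (attracting g).
Proof. exact: (projT2 (cid (hyp_fixpoints g))). Qed.

Lemma north_south_uniq (f : X -> X) (a b a' b' : X) : hausdorff_space X ->
  f <> id -> north_south f a b -> north_south f a' b' -> a = a' /\ b = b'.
Proof.
move=> hX fid ns ns'.
have near_it (c d x : X) V : north_south f c d -> x <> c -> nbhs d V ->
    exists N, forall n, (N <= n)%N -> V (iter n f x).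
  move=> nscd xc dV.
  have [] := ns_attract nscd (@compact_set1 X x) _ dV.
    by move=> /= cx; apply: xc.
  by move=> N _ h; exists N => n Nn; apply: (h n Nn); exists x.
have uniq_lim (c d c' d' x : X) : north_south f c d -> north_south f c' d' ->
    x <> c -> x <> c' -> d = d'.
  move=> nscd nscd' xc xc'; apply: hX => U V dU dV.
  have [N hN] := near_it _ _ _ _ nscd xc dU.
  have [M hM] := near_it _ _ _ _ nscd' xc' dV.
  exists (iter (maxn N M) f x).
  by split; [apply: hN; rewrite leq_maxl|apply: hM; rewrite leq_maxr].
have [x fx] : exists x, f x <> x.
  by apply: contrapT => /forallNP h; apply: fid; apply/funext => x; apply: contrapT.
have bb : b = b'.
  apply: (uniq_lim _ _ _ _ x ns ns') => xE; apply: fx; rewrite xE.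
    exact: ns_fixm ns.
  exact: ns_fixm ns'.
subst b'; split=> //; apply: contrapT => aa'.
have it n : iter n f a = a by elim: n => //= n ->; exact: ns_fixm ns.
apply: (ns_neq ns); apply: hX => U V aU bV.
have [N hN] := near_it _ _ _ _ ns' aa' bV.
exists a; split; first exact: nbhs_singleton.
by rewrite -(it N); exact: hN.
Qed.

Definition conjugate (g g' : hyperbolic_elt) : bool :=
  `[< exists h : G, hyp_val g' = (hyp_val g ^ h)%g >].

Lemma conjugate_equiv : equiv_class_of conjugate.
Proof.
have sym g g' : conjugate g g' -> conjugate g' g.
  move=> /asboolP[h gE]; apply/asboolP; exists (h^-1)%g.
  by rewrite gE -conjgM mulgV conjg1.
split=> [g|g g'|g' g g''].
- by apply/asboolP; exists 1%g; rewrite conjg1.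
- by apply/idP/idP; exact: sym.
- move=> /asboolP[h gE] /asboolP[k gE']; apply/asboolP; exists (h * k)%g.
  by rewrite gE' gE conjgM.
Qed.

Canonical conjugate_eqrel := EquivRelPack conjugate_equiv.

Definition hyperbolic_class := {eq_quot conjugate}.
HB.instance Definition _ := Choice.on hyperbolic_class.
HB.instance Definition _ := EqQuotient.on hyperbolic_class.

(* A nat-indexed set: negative powers do not affect whether the supremum is
   infinite. *)
Definition A_set (eta g : G) : set nat := [set n | hyperbolic (eta * g ^+ n)%g].

Definition minimal_action : Prop :=
  forall x : X, dense (range (fun g => act g x)).

End Dynamics.

Definition borel (X : ptopologicalType) := g_sigma_algebraType (@open X).
HB.instance Definition _ (X : ptopologicalType) := Measurable.on (borel X).

Section Ergodic.
Variables (R : realType) (G : topologicalGroupType) (X : ptopologicalType).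
Variable act : G -> X -> X.
Local Open Scope ereal_scope.

Definition quasi_invariant (mu : set (borel X) -> \bar R) : Prop :=
  forall g : G, pushforward mu (act g : borel X -> borel X) `<< mu /\
                mu `<< pushforward mu (act g : borel X -> borel X).

Definition diag_act (g : G) (p : borel X * borel X) : borel X * borel X :=
  (act g p.1, act g p.2).

(* [A] ranges over the product of the two Borel sigma-algebras. *)
Definition ergodic_square (m : set (borel X * borel X) -> \bar R) : Prop :=
  forall A : set (borel X * borel X), measurable A ->
    (forall g : G, diag_act g @^-1` A = A) -> m A = 0 \/ m (~` A) = 0.

(* [X] is pointed because the library builds sigma-algebras on pointed types;
   the distinguished point plays no role.  Measures are nonzero and sigma-finite, so that the
   product measure is well defined. *)
Record general_geometric_boundary : Prop := {
  ggb_compact : compact [set: X] ;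
  ggb_hausdorff : hausdorff_space X ;
  ggb_nontrivial : exists x y : X, x <> y ;
  ggb_action : continuous_action act ;
  ggb_minimal : minimal_action act ;
  ggb_hyperbolic : exists g : G, hyperbolic act g ;
  ggb_sup : forall (g : hyperbolic_elt act) (eta : G),
    act eta (attracting g) <> repelling g ->
    ereal_sup [set (n%:R)%:E | n in A_set act eta g] = +oo :> \bar R ;
  ggb_ergodic : exists mu mu' : {sigma_finite_measure set (borel X) -> \bar R},
    [/\ mu [set: borel X] <> 0, mu' [set: borel X] <> 0,
        quasi_invariant mu, quasi_invariant mu' & ergodic_square (mu \x mu')]
}.

End Ergodic.

Section Cocycles.
Variables (R : realType) (G : topologicalGroupType) (X : ptopologicalType).
Variable act : G -> X -> X.

(* [R^o] is [R] seen as a module over itself; it makes [G * X -> R^o] a vector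
   space over [R] for the pointwise operations. *)
Definition is_cocycle (c : G * X -> R^o) : Prop :=
  continuous c /\
  forall (g h : G) (x : X), c ((g * h)%g, x) = c (g, act h x) + c (h, x).

Definition cocycle_pred : {pred G * X -> R^o} := [pred c | `[< is_cocycle c >]].

Lemma cocycle_submod : subsemimod_closed cocycle_pred.
Proof.
split; first split.
- by apply/asboolP; split=> [p|g h x]; [exact: cvg_cst|rewrite addr0].
- move=> c d /asboolP[cc cE] /asboolP[dc dE]; apply/asboolP; split.
    by move=> p; apply: (@continuousD R R^o); [exact: cc|exact: dc].
  by move=> g h x; rewrite addrfctE cE dE addrACA.
- move=> a c /asboolP[cc cE]; apply/asboolP; split.
    by move=> p; apply: (@continuousZl_tmp R R^o) ; exact: cc.
  by move=> g h x; rewrite scalrfctE cE scalerDr.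
Qed.

HB.instance Definition _ :=
  GRing.isSubmodClosed.Build R (G * X -> R^o) cocycle_pred cocycle_submod.

Record cocycle := Cocycle {
  cocycle_fun :> G * X -> R^o ;
  cocycle_funP : cocycle_fun \in cocycle_pred
}.

HB.instance Definition _ := [isSub for cocycle_fun].
HB.instance Definition _ := [Choice of cocycle by <:].
HB.instance Definition _ := [SubChoice_isSubLmodule of cocycle by <:].

Definition coboundary : {pred cocycle} := [pred c : cocycle | `[< exists phi : X -> R,
  continuous phi /\
  forall (g : G) (x : X), c (g, x) = phi (act g x) - phi x >]].

Lemma coboundary_submod : subsemimod_closed coboundary.
Proof.
split; first split.
- apply/asboolP; exists (fun=> 0); split=> [p|g x]; first exact: cvg_cst.
  by rewrite subrr.
- move=> c d /asboolP[phi [phic cE]] /asboolP[psi [psic dE]]; apply/asboolP.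
  exists (fun x => phi x + psi x); split=> [x|g x].
    by apply: (@continuousD R R^o); [exact: phic|exact: psic].
  by rewrite [LHS]/= addrfctE cE dE opprD addrACA.
- move=> a c /asboolP[phi [phic cE]]; apply/asboolP.
  exists (fun x => a * phi x); split=> [x|g x].
    by apply: (@continuousZl_tmp R R^o) ; exact: phic.
  by rewrite [LHS]/= scalrfctE cE -mulrBr.
Qed.

HB.instance Definition _ :=
  GRing.isSubmodClosed.Build R cocycle coboundary coboundary_submod.

Definition H1c := Quotient.quot coboundary.
HB.instance Definition _ := GRing.Zmodule.on H1c.
HB.instance Definition _ := EqQuotient.on H1c.

Definition H1c_scale (a : R) : H1c -> H1c := lift_op1 H1c (fun c => a *: c).

Lemma pi_H1c_scale (a : R) : {morph \pi_H1c : c / a *: c >-> H1c_scale a c}.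
Proof.
move=> c; unlock H1c_scale; apply/eqP; rewrite piE /= Quotient.equivE -scalerBr.
by rewrite rpredZ// Quotient.idealrBE reprK.
Qed.
Canonical pi_H1c_scale_morph a := PiMorph1 (pi_H1c_scale a).

Lemma H1c_scaleA (a b : R) (v : H1c) :
  H1c_scale a (H1c_scale b v) = H1c_scale (a * b) v.
Proof. by rewrite -[v]reprK !piE scalerA. Qed.

Lemma H1c_scale1 : left_id 1 H1c_scale.
Proof. by move=> v; rewrite -[v]reprK !piE scale1r. Qed.

Lemma H1c_scaleDr : right_distributive H1c_scale +%R.
Proof. by move=> a u v; rewrite -[u]reprK -[v]reprK !piE scalerDr. Qed.

Lemma H1c_scaleDl (v : H1c) : {morph H1c_scale^~ v : a b / a + b}.
Proof. by move=> a b; rewrite -[v]reprK !piE scalerDl. Qed.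

HB.instance Definition _ := GRing.Zmodule_isLmodule.Build R H1c
  H1c_scaleA H1c_scale1 H1c_scaleDr H1c_scaleDl.

Definition cocycle_class (c : cocycle) : H1c := \pi_H1c c.

(* [C] is a total function on [X * X]; its values on the diagonal are
   irrelevant. *)
Definition B_cocycle (c : cocycle) : Prop :=
  (forall g : G, continuous (fun x : X => c (g, x))) /\
  exists C : X * X -> R,
    {within [set p | p.1 <> p.2], continuous C} /\
    forall (g : G) (x y : X), x <> y ->
      C (act g x, act g y) - C (x, y) = c (g, x) + c (g, y).

(* A function on conjugacy classes; by [length_spectrumE] its value does not
   depend on the representative. *)
Definition length_spectrum (c : cocycle) (q : hyperbolic_class act) : R :=
  c (hyp_val (repr q), attracting (repr q)).

Lemma north_south_conj (g h : G) (a b : X) : continuous_action act ->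
  north_south (act g) a b ->
  north_south (act (g ^ h)%g) (act h^-1%g a) (act h^-1%g b).
Proof.
move=> ha [ab ga gb att rep].
have actK x : act h^-1%g (act h x) = x by rewrite -(actM ha) mulVg act1.
have actVK x : act h (act h^-1%g x) = x by rewrite -(actM ha) mulgV act1.
have ctn k : continuous (act k).
  move=> x; apply: (@continuous_comp X (G * X)%type X (fun y => (k, y))
    (fun p => act p.1 p.2)).
    by apply: cvg_pair => //; exact: cvg_cst.
  exact: act_continuous.
have actJ x : act (g ^ h)%g x = act h^-1%g (act g (act h x)).
  by rewrite /conjg !(actM ha).
have itJ n x : iter n (act (g ^ h)%g) x = act h^-1%g (iter n (act g) (act h x)).
  by elim: n => [|n ih] /=; rewrite ?actK// ih actJ actVK.
have cpt K : compact K -> compact (act h @` K).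
  by move=> cK; apply: continuous_compact => //; exact: continuous_subspaceT.
split.
- by move=> /(congr1 (act h)); rewrite !actVK.
- by rewrite actJ actVK ga.
- by rewrite actJ actVK gb.
- move=> K U cK Ka bU.
  have : \forall n \near \oo, iter n (act g) @` (act h @` K) `<=`
      act h^-1%g @^-1` U.
    apply: att; [exact: cpt| |exact: ctn].
    by move=> [x Kx xa]; apply: Ka; rewrite -xa actK.
  apply: filterS => n sub y [x Kx <-]; rewrite itJ; apply: sub.
  by exists (act h x) => //; exists x.
- move=> K U cK Kb aU.
  have : \forall n \near \oo, iter n (act g) @^-1` (act h @` K) `<=`
      act h^-1%g @^-1` U.
    apply: rep; [exact: cpt| |exact: ctn].
    by move=> [x Kx xb]; apply: Kb; rewrite -xb actK.
  apply: filterS => n sub x; rewrite /= itJ => Kx.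
  rewrite -[x]actK; apply: sub => /=.
  by eexists; [exact: Kx|rewrite actVK].
Qed.

Lemma length_spectrumE (c : cocycle) (g : hyperbolic_elt act) :
  hausdorff_space X -> continuous_action act ->
  length_spectrum c (\pi_(hyperbolic_class act) g) = c (hyp_val g, attracting g).
Proof.
move=> hX ha; rewrite /length_spectrum.
have : conjugate g (repr (\pi_(hyperbolic_class act) g)).
  by rewrite -eqmodE reprK.
move: (repr _) => g' /asboolP[h gE].
have [_ cE] : is_cocycle c by have /asboolP := cocycle_funP c.
have := north_south_conj h ha (north_south_fix g); rewrite -gE => ns.
have g'id : act g' <> id by have /asboolP[] := hyp_valP g'.
have [_ ->] := north_south_uniq hX g'id (north_south_fix g') ns.
have gb := ns_fixp (north_south_fix g).
set b := attracting g in gb *.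
have c1 : c (1%g, b) = 0.
  apply: (@addrI _ (c (1%g, b))); rewrite addr0.
  by rewrite -{1}[b](act1 ha b) -cE mulg1.
have ch : c (h^-1%g, b) + c (h, act h^-1%g b) = 0.
  by rewrite addrC -cE mulgV.
have hb : act h (act h^-1%g b) = b by rewrite -(actM ha) mulgV act1.
rewrite gE /conjg !cE (actM ha (hyp_val g) h) hb gb.
by rewrite addrCA ch addr0.
Qed.

End Cocycles.

(* Main.v *)
Require Import Defs.
From HB Require Import structures.
From mathcomp Require Import all_boot all_order all_algebra.
From mathcomp Require Import all_classical all_reals all_analysis.

Set Implicit Arguments.
Unset Strict Implicit.
Unset Printing Implicit Defensive.

Import Order.TTheory GRing.Theory Num.Theory.
Import numFieldNormedType.Exports.

Local Open Scope classical_set_scope.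
Local Open Scope ring_scope.

(** Put [c = alpha - beta], with potential [C], let [a] and [b] be the repelling
and attracting points of a hyperbolic [gamma], and let [eta b <> a].  For
infinitely many [n] the element [eta gamma^n] is hyperbolic, and its attracting
point [x] tends to [eta b].  As [c (gamma^n, a) = 0] and
[gamma^n x = eta^-1 x], the defining identity of [C] at [(x, a)] turns
[c (eta gamma^n, x) = 0] into
[c (eta, eta^-1 x) + C (eta^-1 x, a) - C (x, a) = 0].  In the limit
[c (eta, b) = C (eta b, a) - C (b, a)], so [x |-> C (x, a)] is a primitive of
[c] along the orbit of [b], hence by minimality off [a]; it extends to [a] by
translation. *)

(** * Topological preliminaries: limits of zeros and perfect spaces *)

(** Used in place of limits along sequences, since [X] is not assumed first countable. *)
Lemma continuous_eq0_closure (R : realType) (X : topologicalType) (f : X -> R)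
    (a : X) : {for a, continuous f} ->
  (forall U, nbhs a U -> exists2 x, U x & f x = 0) -> f a = 0.
Proof.
move=> fa h; apply: contrapT => fa0.
have [|x fx0 fx] := h [set x | f x != 0]; last by rewrite /= fx eqxx in fx0.
apply: (fa [set y | y != 0]).
by apply: open_nbhs_nbhs; split; [exact: open_neq|exact/eqP].
Qed.


Lemma nbhs_neq (X : topologicalType) (a b : X) : hausdorff_space X ->
  a <> b -> nbhs a [set x | x <> b].
Proof.
move=> hX ab; apply: open_nbhs_nbhs; split => //.
exact/closed_openC/accessible_closed_set1/hausdorff_accessible.
Qed.

Lemma perfect_nbhs_neq (X : topologicalType) (x a : X) (U : set X) :
  perfect_set [set: X] -> nbhs x U -> exists2 y, U y & y <> a.
Proof.
move=> pX; rewrite nbhsE => -[V [Vo Vx] VU].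
have [|y [z [Vy Vz yz]]] := perfectTP_ex.1 pX V Vo; first by exists x.
have [ya|/eqP ya] := eqVneq y a; last by exists y => //; exact: VU.
by exists z; [exact: VU|move=> za; rewrite ya za eqxx in yz].
Qed.

(** Having [nbhs y U] and not just [U y] leaves room to move [y] once more, onto a dense orbit. *)
Lemma perfect_nbhs_neq2 (X : topologicalType) (x a b : X) (U : set X) :
  hausdorff_space X -> perfect_set [set: X] -> nbhs x U ->
  exists y, [/\ nbhs y U, y <> a & y <> b].
Proof.
move=> hX pX; rewrite nbhsE => -[V [Vo Vx] VU].
have [y Vy ya] := perfect_nbhs_neq a pX (open_nbhs_nbhs (conj Vo Vx)).
have Vay : nbhs y (V `&` [set z | z <> a]).
  by apply: filterI; [exact: open_nbhs_nbhs|exact: nbhs_neq].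
have [z [Vz za] zb] := perfect_nbhs_neq b pX Vay.
by exists z; split=> //; apply: filterS VU _; exact: open_nbhs_nbhs.
Qed.

Lemma within_offdiag_continuous (X Y : topologicalType) (C : X * X -> Y)
    (a x : X) : hausdorff_space X ->
  {within [set p | p.1 <> p.2], continuous C} -> x <> a ->
  {for x, continuous (fun y => C (y, a))}.
Proof.
move=> hX /subspace_continuousP Cc xa W WC.
have CW : nbhs (x, a) [set p | p.1 <> p.2 -> W (C p)] := Cc (x, a) xa W WC.
have pa : {for x, continuous (fun y => (y, a))}.
  by apply: cvg_pair => //; exact: cvg_cst.
have xCW : \forall y \near x, y <> a -> W (C (y, a)) := pa _ CW.
by apply: filterS2 xCW (nbhs_neq hX xa) => y; exact.
Qed.

(** * Dynamics of hyperbolic elements under a minimal action *)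

Section Action.
Variables (G : topologicalGroupType) (X : ptopologicalType) (act : G -> X -> X).
Hypothesis ha : continuous_action act.

Lemma act_cont (g : G) : continuous (act g).
Proof.
move=> x; apply: (@continuous_comp X (G * X)%type X (fun y => (g, y))
  (fun p => act p.1 p.2)).
  by apply: cvg_pair => //; exact: cvg_cst.
exact: act_continuous.
Qed.

Lemma actK (g : G) : cancel (act g) (act g^-1%g).
Proof. by move=> x; rewrite -(actM ha) mulVg act1. Qed.

Lemma actVK (g : G) : cancel (act g^-1%g) (act g).
Proof. by move=> x; rewrite -(actM ha) mulgV act1. Qed.

Lemma actX (g : G) (n : nat) (x : X) : act (g ^+ n)%g x = iter n (act g) x.
Proof.
by elim: n => [|n ih]; rewrite ?expg0 ?(act1 ha)// expgS (actM ha) ih.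
Qed.

Lemma north_south_cvg (f : X -> X) (a b x : X) (U : set X) :
  north_south f a b -> x <> a -> nbhs b U -> \forall n \near \oo, U (iter n f x).
Proof.
move=> ns xa bU.
have : \forall n \near \oo, iter n f @` [set x] `<=` U.
  by apply: (ns_attract ns) => //; [exact: compact_set1|move=> ax; apply: xa].
by apply: filterS => n; apply; exists x.
Qed.

Lemma minimal_nbhs (b x : X) (U : set X) : minimal_action act -> nbhs x U ->
  exists g, U (act g b).
Proof.
rewrite nbhsE => hmin [V [Vo Vx] VU].
have [|y [Vy [g _ gb]]] := hmin b V _ Vo; first by exists x.
by exists g; apply: VU; rewrite gb.
Qed.

(* The orbit of a point moved by a hyperbolic element accumulates at the
   attracting point without reaching it, so this point is not isolated;
   minimality transports this everywhere. *)
Lemma minimal_hyperbolic_perfect (g : hyperbolic_elt act) :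
  hausdorff_space X -> minimal_action act -> perfect_set [set: X].
Proof.
move=> hX hmin; apply/perfectTP => x xo.
have [_ gid _] : hyperbolic act g by exact/asboolP/hyp_valP.
have ns := north_south_fix g.
have [y yb] : exists y, act g y <> y.
  by apply: contrapT => /forallNP h; apply: gid; apply/funext => y; apply: contrapT.
have ya : y <> repelling g by move=> ya; apply: yb; rewrite ya (ns_fixm ns).
have xx : nbhs x [set x] by exact: open_nbhs_nbhs.
have [h hx] := minimal_nbhs (attracting g) hmin xx.
have : nbhs (attracting g) (act h @^-1` [set x]).
  by apply: act_cont; rewrite hx; exact: xx.
move=> /(north_south_cvg ns ya)[n _ /(_ n (leqnn n))/= nx].
pose f := (hyp_val g ^+ n)%g.
have fy : act f y = act f (attracting g).
  rewrite /f !actX (iter_fix _ (ns_fixp ns)).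
  by apply: (can_inj (actK h)); rewrite nx hx.
by apply: yb; rewrite (can_inj (actK _) fy) (ns_fixp ns).
Qed.

(** The iterates of [x] stay in [U] and converge to the attracting point. *)
Lemma attracting_closed (g : hyperbolic_elt act) (U : set X) (x : X) :
  closed U -> act g @` U `<=` U -> U x -> x <> repelling g -> U (attracting g).
Proof.
move=> cU gU Ux xr; rewrite ((closure_id U).1 cU) => V aV.
have [n _ /(_ n (leqnn n)) Vn] := north_south_cvg (north_south_fix g) xr aV.
exists (iter n (act g) x); split=> //.
by elim: n {Vn} => //= n ih; apply: gU; exists (iter n (act g) x).
Qed.

(* For large [n] the element [eta g^n] maps a small closed neighborhood of
   [eta g^+] into itself, hence has its attracting point there. *)
Lemma attracting_nbhs (g : hyperbolic_elt act) (eta : G) (U : set X) :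
  compact [set: X] -> hausdorff_space X -> minimal_action act ->
  act eta (attracting g) <> repelling g -> nbhs (act eta (attracting g)) U ->
  \forall n \near \oo, forall h : hyperbolic_elt act,
    hyp_val h = (eta * hyp_val g ^+ n)%g -> U (attracting h).
Proof.
move=> cX hX hmin neq nU.
have nU' : nbhs (act eta (attracting g)) (U `&` [set x | x <> repelling g]).
  by apply: filterI => //; exact: nbhs_neq.
have [V nV VU] := compact_regular hX cX filterT nU'.
have pX := minimal_hyperbolic_perfect g hX hmin.
have ns := north_south_fix g.
have cV : compact (closure V).
  by apply: (subclosed_compact _ cX) => //; exact: closed_closure.
have nW : nbhs (attracting g) (act eta @^-1` closure V).
  by apply: act_cont; apply: filterS nV; exact: subset_closure.
(* The compact set [closure V] misses the repelling point, so large powers of [g] send it into the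
   preimage of [closure V] under [eta]. *)
have := ns_attract ns cV (fun r => (VU _ r).2 erefl) nW.
apply: filterS => n sub h hE.
(* The repelling point of [h] may lie in [V]; perfectness provides another point there, to which
   [attracting_closed] applies. *)
have [y Vy yr] := perfect_nbhs_neq (repelling h) pX nV.
apply: (VU _ _).1; apply: (attracting_closed _ _ (subset_closure Vy) yr).
  exact: closed_closure.
move=> _ [z Vz <-]; rewrite hE (actM ha) actX.
by apply: sub; exists z.
Qed.

End Action.

(** * Cocycles with a potential and vanishing length spectrum *)

Section BCocycle.
Variables (R : realType) (G : topologicalGroupType) (X : ptopologicalType).
Variable act : G -> X -> X.
Implicit Types c d : cocycle R act.

Lemma cocycleM c (g h : G) (x : X) :
  c ((g * h)%g, x) = c (g, act h x) + c (h, x).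
Proof. by have /asboolP[_ ->] := cocycle_funP c. Qed.

Lemma cocycleB c d (p : G * X) : (c - d) p = c p - d p.
Proof. by []. Qed.

Lemma cocycle_cont c (g : G) : continuous (fun x : X => c (g, x)).
Proof.
move=> x; apply: (@continuous_comp X (G * X)%type R^o (fun y => (g, y)) c).
  by apply: cvg_pair => //; exact: cvg_cst.
by have /asboolP[cc _] := cocycle_funP c; exact: cc.
Qed.

Lemma cocycle1 c (x : X) : continuous_action act -> c (1%g, x) = 0.
Proof.
move=> ha; apply: (@addrI _ (c (1%g, x))); rewrite addr0.
by rewrite -{1}[x](act1 ha) -cocycleM mulg1.
Qed.

Lemma cocycleX_fix c (g : G) (x : X) (n : nat) : continuous_action act ->
  act g x = x -> c ((g ^+ n)%g, x) = c (g, x) *+ n.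
Proof.
move=> ha gx; elim: n => [|n ih]; first by rewrite expg0 cocycle1.
by rewrite expgSr cocycleM gx ih mulrSr.
Qed.

(** Naming [C] outside the existential of [B_cocycle] allows potentials to be subtracted and
    sliced. *)
Definition potential c (C : X * X -> R) : Prop :=
  {within [set p | p.1 <> p.2], continuous C} /\
  forall (g : G) (x y : X), x <> y ->
    C (act g x, act g y) - C (x, y) = c (g, x) + c (g, y).

Lemma potentialB c d (C D : X * X -> R) :
  potential c C -> potential d D -> potential (c - d) (C - D).
Proof.
move=> [Cc CE] [Dc DE]; split.
  by move=> p; exact: cvgB (Cc p) (Dc p).
move=> g x y xy; rewrite !cocycleB addrACA -opprD -CE// -DE//.
by rewrite (_ : forall p, (C - D) p = C p - D p)// !opprD addrACA.
Qed.

Lemma spectrum_eq0_attracting c (C : X * X -> R) (g : hyperbolic_elt act)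
    (eta : G) : general_geometric_boundary R act -> potential c C ->
  (forall h : hyperbolic_elt act, c (hyp_val h, attracting h) = 0) ->
  act eta (attracting g) <> repelling g ->
  c (eta, attracting g) =
    C (act eta (attracting g), repelling g) - C (attracting g, repelling g).
Proof.
move=> [cX hX _ ha hmin _ hsup _] [Cc CE] c0 neq.
set b := attracting g; set a := repelling g.
have ns : north_south (act g) a b := north_south_fix g.
(* Both [a] and [b] are fixed by [g], so the identity of [C] at [(a, b)] gives
   [c (g, a) + c (g, b) = 0]. *)
have ca : c (hyp_val g, a) = 0.
  have := CE g a b (ns_neq ns).
  by rewrite (ns_fixm ns) (ns_fixp ns) subrr c0 addr0 => <-.
have ba : b <> a by move=> /esym; exact: ns_neq ns.
(* [F] vanishes at the attracting points of the hyperbolic [eta g^n], which accumulate at [eta b].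
   It is continuous there because [b] and [eta b] both differ from [a]. *)
pose F x := c (eta, act eta^-1%g x) + C (act eta^-1%g x, a) - C (x, a).
suff : F (act eta b) = 0.
  by rewrite /F (actK ha) => /eqP; rewrite subr_eq0 => /eqP <-; rewrite addrK.
apply: continuous_eq0_closure => [|U nU].
  have cV : {for act eta b, continuous (act eta^-1%g)} by exact: act_cont.
  apply: (@continuousB R R^o); last exact: within_offdiag_continuous.
  apply: (@continuousD R R^o).
    apply: (@continuous_comp _ _ _ (act eta^-1%g) (fun x => c (eta, x))) => //.
    exact: cocycle_cont.
  apply: (@continuous_comp _ _ _ (act eta^-1%g) (fun x => C (x, a))) => //.
  rewrite (actK ha).
  exact: within_offdiag_continuous.
have nUa : nbhs (act eta b) (U `&` [set x | x <> a]).
  by apply: filterI => //; exact: nbhs_neq.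
have [N _ hN] := attracting_nbhs ha cX hX hmin neq nUa.
have [n An Nn] : exists2 n, A_set act eta g n & (N <= n)%N.
  have /ereal_sup_gt[_ [n An <-]] :
      (N%:R%:E < ereal_sup [set (n%:R : R)%:E | n in A_set act eta g])%E.
    by rewrite hsup// ltry.
  by rewrite lte_fin ltr_nat => /ltnW Nn; exists n.
pose h := HyperbolicElt (asboolT An).
have [Ux xa] := hN n Nn h erefl.
set x := attracting h in Ux xa; exists x => //.
have gx : act (hyp_val g ^+ n)%g x = act eta^-1%g x.
  have hx : act (eta * hyp_val g ^+ n)%g x = x := ns_fixp (north_south_fix h).
  by rewrite -[in RHS]hx (actM ha) (actK ha).
have ga : act (hyp_val g ^+ n)%g a = a by rewrite (actX ha) (iter_fix _ (ns_fixm ns)).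
have := c0 h; rewrite /= cocycleM gx => h0.
have := CE (hyp_val g ^+ n)%g x a xa.
rewrite gx ga (cocycleX_fix c n ha (ns_fixm ns)) ca mul0rn addr0 => cgx.
by rewrite /F -addrA cgx.
Qed.

Lemma spectrum_eq0_coboundary c (C : X * X -> R) :
  general_geometric_boundary R act -> potential c C ->
  (forall h : hyperbolic_elt act, c (hyp_val h, attracting h) = 0) ->
  c \in @coboundary R G X act.
Proof.
move=> hggb cC c0.
have [cX hX [x0 [y0 xy0]] ha hmin [g0 g0h] _ _] := hggb.
pose g := HyperbolicElt (asboolT g0h).
have pX := minimal_hyperbolic_perfect ha g hX hmin.
pose b := attracting g; pose a := repelling g.
(* By density of the orbit of [b], continuous identities off two points may be
   checked on this orbit. *)
have dense_eq (f : X -> R) x u v : {for x, continuous f} ->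
    (forall eta, act eta b <> u -> act eta b <> v -> f (act eta b) = 0) ->
    f x = 0.
  move=> fx f0; apply: (continuous_eq0_closure fx) => U nU.
  have [y [nyU yu yv]] := perfect_nbhs_neq2 u v hX pX nU.
  have nyuv : nbhs y (U `&` ([set z | z <> u] `&` [set z | z <> v])).
    by apply: filterI => //; apply: filterI; exact: nbhs_neq.
  have [eta [Ue [eu ev]]] := minimal_nbhs b hmin nyuv.
  by exists (act eta b) => //; exact: f0.
have Cac x : x <> a -> {for x, continuous (fun y => C (y, a))}.
  by move=> xa; exact: within_offdiag_continuous cC.1 xa.
have primitive eta x : x <> a -> act eta x <> a ->
    c (eta, x) = C (act eta x, a) - C (x, a).
  move=> xa ea; apply/eqP; rewrite -subr_eq0; apply/eqP.
  (* The two excluded points are those where [C (x, a)] or [C (eta x, a)] falls on the diagonal. *)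
  apply: (dense_eq (fun x => c (eta, x) - (C (act eta x, a) - C (x, a))) x a
    (act eta^-1%g a)).
    apply: (@continuousB R R^o); first exact: cocycle_cont.
    apply: (@continuousB R R^o); last exact: Cac.
    apply: (@continuous_comp _ _ _ (act eta) (fun y => C (y, a))).
      exact: act_cont.
    exact: Cac.
  move=> z za zv; have ez : act (eta * z)%g b <> a.
    by rewrite (actM ha) => /(congr1 (act eta^-1%g)); rewrite (actK ha).
  (* Subtracting the formulas for [eta z] and [z] cancels [C (b, a)]. *)
  have := spectrum_eq0_attracting hggb cC c0 ez.
  rewrite cocycleM (spectrum_eq0_attracting hggb cC c0 za) -/a -/b (actM ha).
  by move=> /eqP; rewrite addrA (inj_eq (addIr _)) => /eqP <-; rewrite addrK subrr.
have [e ea] : exists e, act e a <> a.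
  have [y _ ya] := perfect_nbhs_neq a pX (@filterT _ (nbhs x0) _).
  exact: (minimal_nbhs a hmin (nbhs_neq hX ya)).
(* The value at [a] is forced by the coboundary equation for [e] at [a]. *)
pose phi x := if pselect (x = a) then C (act e a, a) - c (e, a) else C (x, a).
have phiE x : x <> a -> phi x = C (x, a) by rewrite /phi; case: pselect.
have phic : continuous phi.
  move=> x; have [->{x}|/eqP xa] := eqVneq x a.
    have pa : phi a = C (act e a, a) - c (e, a) by rewrite /phi; case: pselect.
    (* By [primitive], this function agrees with [phi] near [a], except at [a] itself, where they
       agree by definition. *)
    have ec : {for a, continuous (fun x => C (act e x, a) - c (e, x))}.
      apply: (@continuousB R R^o); last exact: cocycle_cont.
      apply: (@continuous_comp _ _ _ (act e) (fun y => C (y, a))).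
        exact: act_cont.
      exact: Cac.
    rewrite /continuous_at pa; apply: cvg_trans ec.
    apply: near_eq_cvg.
    have : nbhs a (act e @^-1` [set x | x <> a]).
      by apply: act_cont => //; exact: nbhs_neq.
    apply: filterS => x /= ex; have [->//|/eqP xa] := eqVneq x a.
    by rewrite phiE// (primitive e x)// opprB addrC subrK.
  rewrite /continuous_at (phiE _ xa); apply: cvg_trans (Cac _ xa).
  apply: near_eq_cvg; apply: filterS (nbhs_neq hX xa) => y ya.
  by rewrite phiE.
apply/asboolP; exists phi; split=> // eta x; apply/eqP; rewrite -subr_eq0; apply/eqP.
(* Now that [phi] is continuous everywhere, density also covers the cases [x = a] and
   [eta x = a]. *)
apply: (dense_eq (fun x => c (eta, x) - (phi (act eta x) - phi x)) x a
  (act eta^-1%g a)).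
  apply: (@continuousB R R^o); first exact: cocycle_cont.
  apply: (@continuousB R R^o); last exact: phic.
  apply: (@continuous_comp _ _ _ (act eta) phi); first exact: act_cont.
  exact: phic.
move=> z za zv; have ez : act eta (act z b) <> a.
  by move=> /(congr1 (act eta^-1%g)); rewrite (actK ha).
by rewrite !phiE// primitive// subrr.
Qed.

End BCocycle.

Theorem theoremA6 (R : realType) (G : topologicalGroupType)
    (X : ptopologicalType) (act : G -> X -> X) (alpha beta : cocycle R act) :
  general_geometric_boundary R act ->
  B_cocycle alpha -> B_cocycle beta ->
  length_spectrum alpha = length_spectrum beta ->
  (exists phi : X -> R, continuous phi /\
     forall (g : G) (x : X),
       alpha (g, x) - beta (g, x) = phi (act g x) - phi x) /\
  cocycle_class alpha = cocycle_class beta.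
Proof.
move=> hggb [_ [C hC]] [_ [D hD]] ell.
have cob : alpha - beta \in @coboundary R G X act.
  apply: (spectrum_eq0_coboundary hggb (potentialB hC hD)) => h.
  have [_ hX _ ha _ _ _ _] := hggb.
  (* The spectra agree as functions on conjugacy classes; they are compared at the class of [h]. *)
  rewrite cocycleB -!length_spectrumE// ell.
  by rewrite subrr.
split; first by move: cob => /asboolP.
by apply/eqP; rewrite /cocycle_class piE Quotient.equivE.
Qed.
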